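(* Let $\sigma\in\mathrm{Aut}_{\mathbb F}(A)$ and let $l_1,\ldots,l_t\in\{1,\ldots,r\}$ be such that $l_i\not\equiv_\sigma l_j$ for $i\ne j$. Furthermore assume $o_{l_i}(\sigma)>1$, that is, $\sigma(\varepsilon^{(l_i)})\ne\varepsilon^{(l_i)}$, for all $i=1,\ldots,t$. Then for all $d_1,\ldots,d_t\in\mathbb N_0$ there exists a unit $w\in A[z;\sigma]$ such that $g:=\sum_{i=1}^tw^{(l_i)}$ is reduced and $\deg_zw^{(l_i)}=d_i$ for $i=1,\ldots,t$.
   Context: $\mathbb F$ is a finite field and $n\ge1$ is coprime to $|\mathbb F|$. $A:=\mathbb F[x]/\langle x^n-1\rangle$ and $x^n-1=\pi_1\cdots\pi_r$ with monic irreducible pairwise different $\pi_i\in\mathbb F[x]$, ordered by nondecreasing degree. For $k=1,\ldots,r$, $\varepsilon^{(k)}\in A$ is the primitive idempotent with $\varepsilon^{(k)}\equiv\delta_{kj}\pmod{\pi_j}$ for all $j$. $\mathrm{Aut}_{\mathbb F}(A)$ is the group of $\mathbb F$-algebra automorphisms of $A$; each such $\sigma$ permutes the $\varepsilon^{(k)}$. Write $k\equiv_\sigma l$ if $\sigma^i(\varepsilon^{(k)})=\varepsilon^{(l)}$ for some $i\in\mathbb N_0$ (an equivalence relation on $\{1,\ldots,r\}$), and $o_l(\sigma):=\min\{m\ge1\mid\sigma^m(\varepsilon^{(l)})=\varepsilon^{(l)}\}$. $A[z;\sigma]$ is the skew-polynomial ring with elements $\sum_j z^ja_j$ ($a_j\in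 A$, coefficients on the right), usual addition, and multiplication determined by $az=z\sigma(a)$ for $a\in A$; $\deg_z$ is the degree in $z$. For $f\in A[z;\sigma]$ put $f^{(k)}:=\varepsilon^{(k)}f$. Monomials are the elements $z^\mu\varepsilon^{(k)}$, ordered by $z^\mu\varepsilon^{(k)}<z^\nu\varepsilon^{(l)}$ iff $\mu<\nu$, or $\mu=\nu$ and $k<l$. The terms of $f=\sum_\nu z^\nu f_\nu$ are the elements $z^\nu\varepsilon^{(l)}f_\nu$; for $f\neq 0$, $LM(f)$ is the largest monomial $z^\mu\varepsilon^{(k)}$ with $\varepsilon^{(k)}f_\mu\ne0$. $f$ is reduced if for all $k\ne l$ (with $f^{(l)}\neq0$) no nonzero term of $f^{(k)}$ is right divisible by $LM(f^{(l)})$, i.e. equals $h\cdot LM(f^{(l)})$ with $h\in A[z;\sigma]$. $\mathbb N_0$ denotes the nonnegative integers. *)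

(* Defs.v *)
From HB Require Import structures.
From mathcomp Require Import all_boot all_order all_algebra.

Set Implicit Arguments.
Unset Strict Implicit.
Unset Printing Implicit Defensive.

Import GRing.Theory.
Local Open Scope ring_scope.

Definition two_sided_unit (R : nzRingType) (x : R) : Prop :=
  exists y : R, x * y = 1 /\ y * x = 1.

(* An element of [skewpoly sigma] is the list of its right coefficients: the
   polynomial with coefficients [a_j] stands for [\sum_j z^j a_j].  Additively
   this is {poly A}; from a z = z sigma(a) the product is
   (z^i a) (z^j b) = z^(i + j) sigma^j(a) b. *)
Definition skewpoly (A : nzRingType) (sigma : {rmorphism A -> A}) : Type :=
  {poly A}.

Section SkewPoly.

Variables (A : nzRingType) (sigma : {rmorphism A -> A}).
Local Notation S := (skewpoly sigma).

HB.instance Definition _ := GRing.Zmodule.copy S {poly A}.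

Definition skcoef (f : S) (i : nat) : A := (f : {poly A})`_i.

Definition sksize (f : S) : nat := size (f : {poly A}).

Definition skC (a : A) : S := (a%:P : {poly A}).

Definition skZ : S := ('X : {poly A}).

Definition skew_mul (f g : S) : S :=
  (\poly_(k < (sksize f + sksize g).-1)
      \sum_(i < k.+1) iter (k - i) sigma (skcoef f i) * skcoef g (k - i)
    : {poly A}).

Lemma skewP (f g : S) : skcoef f =1 skcoef g <-> f = g.
Proof. exact: polyP. Qed.

Lemma skcoefD (f g : S) i : skcoef (f + g) i = skcoef f i + skcoef g i.
Proof. exact: coefD. Qed.

Lemma skcoefC a i : skcoef (skC a) i = if i == 0 then a else 0.
Proof. exact: coefC. Qed.

Lemma skcoefZ i : skcoef skZ i = (i == 1)%:R.
Proof. exact: coefX. Qed.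

Lemma skcoef_default (f : S) i : (sksize f <= i)%N -> skcoef f i = 0.
Proof. exact: nth_default. Qed.

Lemma iter_rmorphM k : {morph iter k sigma : a b / a * b}.
Proof. by elim: k => // k IHk a b; rewrite !iterS IHk rmorphM. Qed.

Lemma iter_rmorphD k : {morph iter k sigma : a b / a + b}.
Proof. by elim: k => // k IHk a b; rewrite !iterS IHk rmorphD. Qed.

Lemma iter_rmorph0 k : iter k sigma 0 = 0.
Proof. by elim: k => //= k ->; rewrite rmorph0. Qed.

Lemma iter_rmorph1 k : iter k sigma 1 = 1.
Proof. by elim: k => //= k ->; rewrite rmorph1. Qed.

Lemma iter_rmorph_sum k (I : Type) (s : seq I) (P : pred I) (F : I -> A) :
  iter k sigma (\sum_(i <- s | P i) F i) = \sum_(i <- s | P i) iter k sigma (F i).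
Proof. exact: (big_morph _ (iter_rmorphD k) (iter_rmorph0 k)). Qed.

Lemma skcoef_mul f g k :
  skcoef (skew_mul f g) k =
    \sum_(i < k.+1) iter (k - i) sigma (skcoef f i) * skcoef g (k - i).
Proof.
rewrite /skcoef /skew_mul coef_poly ltn_predRL; case: leqP => // le_fg_k.
rewrite big1 // => i _; have [le_f_i | lt_i_f] := leqP (sksize f) i.
  by rewrite nth_default // iter_rmorph0 mul0r.
rewrite [X in _ * X]nth_default ?mulr0 // leq_subRL -ltnS //.
by rewrite (leq_trans _ le_fg_k) // ltn_add2r.
Qed.

Lemma skcoef_mul_rev f g k :
  skcoef (skew_mul f g) k =
    \sum_(i < k.+1) iter i sigma (skcoef f (k - i)) * skcoef g i.
Proof.
rewrite skcoef_mul (reindex_inj rev_ord_inj) /=.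
by apply: eq_bigr => i _; rewrite (sub_ordK i).
Qed.

Fact skew_mulA : associative skew_mul.
Proof.
move=> f g h; apply/skewP => k; rewrite skcoef_mul skcoef_mul_rev.
pose c3 (i j : nat) := iter (k - i) sigma (skcoef f i) *
  (iter j sigma (skcoef g (k - i - j)) * skcoef h j).
transitivity (\sum_(i < k.+1) \sum_(j < k.+1 | (j <= k - i)%N) c3 i j).
  apply: eq_bigr => /= i _; rewrite skcoef_mul_rev big_distrr /=.
  by rewrite (big_ord_narrow_leq (leq_subr _ _)).
rewrite (exchange_big_dep predT) //=; apply: eq_bigr => j _.
transitivity (\sum_(i < k.+1 | (i <= k - j)%N) c3 i j).
  apply: eq_bigl => i; rewrite -ltnS -(ltnS i) -!subSn ?leq_ord //.
  by rewrite -subn_gt0 -(subn_gt0 i) -!subnDA addnC.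
rewrite (big_ord_narrow_leq (leq_subr _ _)) skcoef_mul iter_rmorph_sum.
rewrite big_distrl /=; apply: eq_bigr => i _.
have le_jk : (j <= k)%N := leq_ord j.
have le_ij : (j + i <= k)%N by rewrite -leq_subRL // leq_ord.
rewrite /c3 iter_rmorphM -iterD mulrA -!subnDA [(i + j)%N]addnC.
have -> : (k - i = j + (k - (j + i)))%N; last by [].
by rewrite subnDA addnBA ?subnKC // leq_subRL.
Qed.

Fact skew_mul1 : left_id (skC 1) skew_mul.
Proof.
move=> f; apply/skewP => k; rewrite skcoef_mul big_ord_recl subn0.
rewrite big1 => [|i _]; first by rewrite skcoefC iter_rmorph1 mul1r addr0.
by rewrite skcoefC /= iter_rmorph0 mul0r.
Qed.

Fact skew_mulr1 : right_id (skC 1) skew_mul.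
Proof.
move=> f; apply/skewP => k; rewrite skcoef_mul_rev big_ord_recl subn0.
rewrite big1 => [|i _]; first by rewrite skcoefC mulr1 addr0.
by rewrite skcoefC /= mulr0.
Qed.

Fact skew_mulDl : left_distributive skew_mul +%R.
Proof.
move=> f g h; apply/skewP => k; rewrite skcoefD !skcoef_mul -big_split.
by apply: eq_bigr => i _; rewrite skcoefD iter_rmorphD mulrDl.
Qed.

Fact skew_mulDr : right_distributive skew_mul +%R.
Proof.
move=> f g h; apply/skewP => k; rewrite skcoefD !skcoef_mul -big_split.
by apply: eq_bigr => i _; rewrite skcoefD mulrDr.
Qed.

Fact skew1_neq0 : skC 1 != 0.
Proof. by rewrite polyC_eq0 oner_neq0. Qed.

HB.instance Definition _ := GRing.Zmodule_isNzRing.Build S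
  skew_mulA skew_mul1 skew_mulr1 skew_mulDl skew_mulDr skew1_neq0.

Lemma skcoefM (f g : S) k :
  skcoef (f * g) k =
    \sum_(i < k.+1) iter (k - i) sigma (skcoef f i) * skcoef g (k - i).
Proof. exact: skcoef_mul. Qed.

Lemma skcoefMC (f : S) a k : skcoef (f * skC a) k = skcoef f k * a.
Proof.
rewrite [skcoef _ _]skcoef_mul_rev big_ord_recl subn0 big1 => [|i _].
  by rewrite skcoefC addr0.
by rewrite skcoefC /= mulr0.
Qed.

Lemma skcoefCM (f : S) a k :
  skcoef (skC a * f) k = iter k sigma a * skcoef f k.
Proof.
rewrite skcoefM big_ord_recl subn0 big1 => [|i _]; first by rewrite skcoefC addr0.
by rewrite skcoefC /= iter_rmorph0 mul0r.
Qed.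

Lemma skcoefMZ (f : S) k :
  skcoef (f * skZ) k = if k is k'.+1 then sigma (skcoef f k') else 0.
Proof.
rewrite [skcoef _ _]skcoef_mul_rev; case: k => [|k].
  by rewrite big_ord1 skcoefZ mulr0.
rewrite big_ord_recl big_ord_recl big1 => [|i _]; last by rewrite skcoefZ mulr0.
by rewrite !skcoefZ /= mulr0 add0r addr0 mulr1 subSS subn0.
Qed.

Lemma skC_mulZ a : skC a * skZ = skZ * skC (sigma a).
Proof.
apply/skewP => k; rewrite skcoefMZ skcoefMC skcoefZ.
case: k => [|[|k]]; rewrite ?skcoefC /= ?mul0r ?mul1r //.
by rewrite rmorph0.
Qed.

Lemma skcoefZn m k : skcoef (skZ ^+ m) k = (k == m)%:R.
Proof.
elim: m k => [|m IHm] [|k]; rewrite ?expr0 ?exprSr.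
- exact: skcoefC.
- exact: skcoefC.
- by rewrite skcoefMZ.
by rewrite skcoefMZ IHm rmorph_nat.
Qed.

Lemma skew_def (f : S) :
  f = \sum_(j < sksize f) skZ ^+ j * skC (skcoef f j).
Proof.
have coef_sk (I : Type) (s : seq I) (F : I -> S) k :
    skcoef (\sum_(i <- s) F i) k = \sum_(i <- s) skcoef (F i) k.
  exact: (big_morph (skcoef^~ k) (fun f g => skcoefD f g k) (coef0 _ k)).
apply/skewP => k; rewrite coef_sk.
under eq_bigr => j _ do rewrite skcoefMC skcoefZn.
have [lt_k | le_k] := ltnP k (sksize f).
  rewrite (bigD1 (Ordinal lt_k)) //= eqxx mul1r big1 ?addr0 // => j neq_j.
  by rewrite eq_sym -(inj_eq val_inj) /= in neq_j; rewrite (negPf neq_j) mul0r.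
rewrite skcoef_default // big1 // => j _.
by rewrite gtn_eqF ?mul0r // (leq_trans (ltn_ord j)).
Qed.

Section Monomials.

Variables (r : nat) (eps : 'I_r -> A).

Definition skcomp (k : 'I_r) (f : S) : S := skC (eps k) * f.

(* The pair [(mu, k)] indexes the monomial z^mu eps_k. *)
Definition monom (p : nat * 'I_r) : S := skZ ^+ p.1 * skC (eps p.2).

Definition monom_lt (p q : nat * 'I_r) : bool :=
  (p.1 < q.1)%N || (p.1 == q.1) && (p.2 < q.2)%N.

Definition term (f : S) (p : nat * 'I_r) : S :=
  skZ ^+ p.1 * skC (eps p.2 * skcoef f p.1).

(* [p] indexes the leading monomial LM(f); see LM_exists and LM_unique. *)
Definition is_LM (f : S) (p : nat * 'I_r) : Prop :=
  eps p.2 * skcoef f p.1 != 0 /\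
  forall q, eps q.2 * skcoef f q.1 != 0 -> q != p -> monom_lt q p.

Definition right_divisible (f g : S) : Prop := exists h : S, f = h * g.

Definition reduced (f : S) : Prop :=
  forall k l : 'I_r, k != l -> skcomp l f != 0 ->
  forall p, is_LM (skcomp l f) p ->
  forall q, term (skcomp k f) q != 0 ->
    ~ right_divisible (term (skcomp k f) q) (monom p).

Lemma LM_unique f p q : is_LM f p -> is_LM f q -> p = q.
Proof.
move=> [nz_p max_p] [nz_q max_q]; apply/eqP/negPn/negP => neq_pq.
have := max_q p nz_p neq_pq; rewrite eq_sym in neq_pq.
have := max_p q nz_q neq_pq; rewrite /monom_lt.
by case: ltngtP => //= _; case: ltngtP.
Qed.

Lemma LM_exists f : \sum_k eps k = 1 -> f != 0 -> exists p, is_LM f p.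
Proof.
move=> sum_eps nz_f; have sf : (0 < sksize f)%N by rewrite size_poly_gt0.
pose mu := (sksize f).-1.
pose P (k : 'I_r) := eps k * skcoef f mu != 0.
have /existsP[k0 Pk0] : [exists k, P k].
  apply: contraR nz_f => /existsPn nP.
  rewrite -lead_coef_eq0 /lead_coef -[_`__]/(skcoef f mu).
  rewrite -[skcoef f mu]mul1r -sum_eps big_distrl big1 //= => k _.
  by apply/eqP; have := nP k; rewrite negbK.
have [k Pk max_k] := arg_maxnP (fun k : 'I_r => k : nat) Pk0.
exists (mu, k); split => //= -[nu l] /= nz_q neq_q; rewrite /monom_lt /=.
have le_nu : (nu <= mu)%N.
  rewrite -ltnS prednK // ltnNge; apply: contraNN nz_q => le_nu.
  by rewrite skcoef_default // mulr0.
case: ltngtP le_nu => //= eq_nu _; subst nu.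
rewrite ltn_neqAle [(l <= k)%N]max_k // andbT.
by apply: contraNN neq_q => /eqP/val_inj->.
Qed.

End Monomials.

End SkewPoly.

Lemma period_exists (T : finType) (s : T -> T) (s_inj : injective s) (x : T) :
  exists m, (0 < m)%N && (iter m s x == x).
Proof.
exists (fingraph.order s x); rewrite fingraph.order_gt0 /=.
by apply/eqP/fingraph.iter_order.
Qed.

Definition period (T : finType) (s : T -> T) (s_inj : injective s) (x : T) :
  nat := ex_minn (period_exists s_inj x).

Definition same_orbit (T I : Type) (s : T -> T) (e : I -> T) (k l : I) : Prop :=
  exists i : nat, iter i s (e k) = e l.

(* For n = 0 the library replaces the modulus 0 by 'X. *)
Definition cyclic_algebra (F : finFieldType) (n : nat) :=
  {poly %/ ('X^n - 1 : {poly F})}.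

HB.instance Definition _ (F : finFieldType) (n : nat) :=
  GRing.ComUnitAlgebra.on (cyclic_algebra F n).
HB.instance Definition _ (F : finFieldType) (n : nat) :=
  Finite.on (cyclic_algebra F n).

Definition crt_idempotents (F : finFieldType) (n r : nat)
    (ppi : 'I_r -> {poly F}) (eps : 'I_r -> cyclic_algebra F n) : Prop :=
  forall k j, (eps k : {poly F}) %% ppi j = (k == j)%:R %% ppi j.

Lemma crt_idempotents_sum (F : finFieldType) (n r : nat)
    (ppi : 'I_r -> {poly F}) (eps : 'I_r -> cyclic_algebra F n) :
  (0 < n)%N -> (forall k, ppi k \is monic) ->
  (forall k, irreducible_poly (ppi k)) -> injective ppi ->
  'X^n - 1 = \prod_(k < r) ppi k -> crt_idempotents ppi eps ->
  \sum_k eps k = 1.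
Proof.
move=> n_gt0 mon irr inj prodE crt; apply/eqP; rewrite -subr_eq0.
set q := _ - 1.
have dvd_q j : ppi j %| (q : {poly F}).
  have -> : (q : {poly F}) = \sum_k (eps k : {poly F}) - 1.
    by rewrite /q -poly_of_qpoly_sum.
  have big_modp : (\sum_k (eps k : {poly F})) %% ppi j
                = \sum_k ((eps k : {poly F}) %% ppi j).
    elim: (index_enum _) => [|k s IHs]; first by rewrite !big_nil mod0p.
    by rewrite !big_cons modpD IHs.
  apply/eqP; rewrite modpD modpN big_modp (bigD1 j) //= crt eqxx big1.
    by rewrite addr0 subrr.
  by move=> k neq_kj; rewrite crt (negPf neq_kj) mod0p.
have co j k : j != k -> coprimep (ppi j) (ppi k).
  move=> neq_jk; rewrite irreducible_poly_coprime //.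
  apply: contraNN neq_jk => dvd_jk; apply/eqP/inj/eqP.
  have [_ irr_k] := irr k; have [gt1 _] := irr j.
  rewrite -eqp_monic //; apply: irr_k => //.
  by rewrite neq_ltn gt1 orbT.
have prod_dvd (s : seq 'I_r) : uniq s -> \prod_(j <- s) ppi j %| (q : {poly F}).
  elim: s => [|j s IHs] /=; first by rewrite big_nil dvd1p.
  case/andP=> s'j /IHs dvd_s; rewrite big_cons Gauss_dvdp ?dvd_q //.
  rewrite big_seq; apply: (big_ind (coprimep (ppi j))) => [|f g cof cog|k s_k].
  - exact: coprimep1.
  - by rewrite coprimepMr cof.
  by apply: co; apply: contraNneq s'j => ->.
have {prod_dvd} := prod_dvd _ (index_enum_uniq 'I_r); rewrite -prodE => dvd_q_n.
have : (q : {poly F}) == 0; last by [].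
apply: contraTT dvd_q_n => nz_q; apply/negP => /(dvdp_leq nz_q).
have sz_mk : size (mk_monic ('X^n - 1 : {poly F})) = size ('X^n - 1 : {poly F}).
  rewrite /mk_monic size_Xn_sub_1 // ltnS n_gt0 (monicXnsubC 1 n_gt0).
  by rewrite size_Xn_sub_1.
by rewrite leqNgt -sz_mk size_mk_monic.
Qed.

(* Main.v *)
Require Import Defs.
From mathcomp Require Import all_boot all_order all_algebra.

(** Write [e_i = eps (l i)].  From [a z = z sigma(a)] one gets
    [e_i z^m e_j z^k = z^m (sigma^m(e_i) e_j) z^k].  Distinct primitive
    idempotents are orthogonal and [sigma] permutes them, so a product of such
    monomials vanishes as soon as [sigma^m(e_i) <> e_j].  A sum of monomials
    whose pairwise products all vanish in this way squares to zero, and adding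
    [1] to it gives a unit ([skCZn_sum_sq0], [two_sided_unit_1Dsq0]).

    If [d_i > 0] and [sigma^(d_i)] moves [e_i], then [N_i = e_i z^(d_i)] is such
    a monomial, and [e_i (1 + N_i) = e_i + e_i z^(d_i)] has degree [d_i].  If
    [sigma^(d_i)] fixes [e_i], this monomial is not nilpotent, but it factors as
    [(e_i z) (sigma(e_i) z^(d_i - 1))], whose two factors do square to zero,
    because [sigma] moves [e_i]; then
    [e_i (1 + e_i z) (1 + sigma(e_i) z^(d_i - 1)) = e_i + e_i z + e_i z^(d_i)]
    again has degree [d_i].  If [d_i = 0], nothing is inserted.  Monomials
    attached to different [e_i] have product zero, since the orbits are
    disjoint, so all the [i] are treated at once by a single product
    [(1 + N) (1 + M)], the [orbit_unit].

    Reducedness holds for every [w] ([reduced_sum_skcomp]): all terms of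
    [e_i w] lie over the [sigma]-orbit of [e_i], and right multiples of a
    monomial [z^nu eps_p] keep the idempotent [eps_p], so that no term of one
    component is divisible by the leading monomial of another.

    The arithmetic of [x^n - 1] enters only through the fact that the [eps k]
    are distinct primitive idempotents ([eps_prim], [eps_inj]). *)

Set Implicit Arguments.
Unset Strict Implicit.
Unset Printing Implicit Defensive.

Import GRing.Theory.
Local Open Scope ring_scope.

(** * Primitive idempotents *)

Section PrimitiveIdempotents.

Variable A : comNzRingType.
Implicit Types e f : A.

(** In a commutative ring, the absence of a proper decomposition of [e] into
    orthogonal idempotents amounts to this dichotomy: [e = f e + (1 - f) e]. *)
Definition primitive_idem e : Prop :=
  [/\ e != 0, e * e = e & forall f, f * f = f -> f * e = 0 \/ f * e = e].

Lemma primitive_idem_orth e f :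
  primitive_idem e -> primitive_idem f -> e <> f -> e * f = 0.
Proof.
move=> [_ ee prim_e] [_ ff prim_f] neq_ef.
have [//|eq_ef] := prim_f e ee.
have [|eq_fe] := prim_e f ff; first by rewrite mulrC.
by case: neq_ef; rewrite -eq_fe mulrC.
Qed.

Lemma primitive_idem_iter (s : {rmorphism A -> A}) m e :
  bijective s -> primitive_idem e -> primitive_idem (iter m s e).
Proof.
move=> s_bij; have s_inj := bij_inj s_bij.
elim: m => //= m IHm /IHm{IHm}; move: (iter m s e) => {}e [nz_e ee prim_e].
split=> [||f ff].
- by rewrite -(rmorph0 s) (inj_eq s_inj).
- by rewrite -rmorphM ee.
have [s' _ s'K] := s_bij; rewrite -(s'K f) in ff *.
have {}ff : s' f * s' f = s' f by apply: s_inj; rewrite rmorphM.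
rewrite -rmorphM; have [->|->] := prim_e _ ff; last by right.
by left; rewrite rmorph0.
Qed.

End PrimitiveIdempotents.

(** * Skew-polynomial arithmetic and units *)

Lemma two_sided_unitM (R : nzRingType) (x y : R) :
  two_sided_unit x -> two_sided_unit y -> two_sided_unit (x * y).
Proof.
move=> [x' [xx' x'x]] [y' [yy' y'y]]; exists (y' * x'); split.
  by rewrite mulrA -(mulrA x) yy' mulr1.
by rewrite mulrA -(mulrA y') x'x mulr1.
Qed.

Lemma two_sided_unit_1Dsq0 (R : nzRingType) (x : R) :
  x * x = 0 -> two_sided_unit (1 + x).
Proof.
move=> xx0; exists (1 - x).
by rewrite !mulrDl !mulrDr !mulrN !mulNr !mul1r !mulr1 xx0 oppr0 !addr0
  addrNK addrK.
Qed.

Section SkewArithmetic.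

Variables (A : nzRingType) (sigma : {rmorphism A -> A}).
Local Notation S := (skewpoly sigma).
Local Notation skC := (skC sigma).
Local Notation skZ := (skZ sigma).
Implicit Types f g : S.

Lemma skC0 : skC 0 = 0.
Proof. exact: polyC0. Qed.

Lemma skcoef_sum (I : Type) (s : seq I) (P : pred I) (h : I -> S) k :
  skcoef (\sum_(i <- s | P i) h i) k = \sum_(i <- s | P i) skcoef (h i) k.
Proof.
apply: (big_morph (fun f : S => skcoef f k)) => [f g|]; first exact: skcoefD.
exact: coef0.
Qed.

Lemma skcoefCZn a m k :
  skcoef (skC a * skZ ^+ m : S) k = iter k sigma a *+ (k == m).
Proof. by rewrite skcoefCM skcoefZn mulr_natr. Qed.

Lemma skCM a b : skC a * skC b = skC (a * b) :> S.
Proof.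
apply/skewP => -[|k]; rewrite skcoefCM !skcoefC //=.
by rewrite mulr0.
Qed.

Lemma skC_mulZn a m : skC a * skZ ^+ m = skZ ^+ m * skC (iter m sigma a) :> S.
Proof.
apply/skewP => k; rewrite skcoefCZn skcoefMC skcoefZn mulr_natl.
by case: eqP => // ->.
Qed.

(** Moving the inner coefficients together leaves one scalar,
    [sigma^m(a) b], on which the vanishing of the product depends. *)
Lemma skCZn_mul a m b k :
  (skC a * skZ ^+ m) * (skC b * skZ ^+ k) =
    skZ ^+ m * skC (iter m sigma a * b) * skZ ^+ k :> S.
Proof. by rewrite skC_mulZn !mulrA -(mulrA (skZ ^+ m)) skCM. Qed.

(** The source of all units below: [1 + N] is a unit for such an [N]. *)
Lemma skCZn_sum_sq0 (I : finType) (P : pred I) (a : I -> A) (m : I -> nat) :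
  (forall i j, P i -> P j -> iter (m i) sigma (a i) * a j = 0) ->
  let N := \sum_(i | P i) skC (a i) * skZ ^+ m i : S in N * N = 0.
Proof.
move=> orth /=; rewrite big_distrlr /= big1 // => i Pi.
rewrite big1 // => j Pj; rewrite skCZn_mul orth //.
by rewrite skC0 mulr0 mul0r.
Qed.

Lemma sksize_eqS f m :
  skcoef f m != 0 -> (forall k, (m < k)%N -> skcoef f k = 0) ->
  sksize f = m.+1.
Proof.
move=> nz_m high; apply/eqP; rewrite eqn_leq; apply/andP; split.
  by apply/leq_sizeP => k; apply: high.
by rewrite ltnNge; apply: contraNN nz_m => /skcoef_default->.
Qed.

Lemma skcoef_skcomp (r : nat) (eps : 'I_r -> A) k f m :
  skcoef (skcomp eps k f) m = iter m sigma (eps k) * skcoef f m.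
Proof. exact: skcoefCM. Qed.

End SkewArithmetic.

(** * A unit with components of prescribed degree *)

Section OrbitUnit.

Variables (A : comNzRingType) (sigma : {rmorphism A -> A}).
Hypothesis sigma_bij : bijective sigma.
Local Notation S := (skewpoly sigma).
Local Notation skC := (skC sigma).
Local Notation skZ := (skZ sigma).
Variables (I : finType) (e : I -> A) (d : I -> nat).
Hypothesis e_prim : forall i, primitive_idem (e i).
Hypothesis e_orbits : forall i j, i != j -> forall m, iter m sigma (e i) <> e j.

Let iter_inj m : injective (iter m sigma).
Proof. by elim: m => // m IHm x y /(bij_inj sigma_bij)/IHm. Qed.

(** Cancelling the smaller power of the injective [sigma] reduces to
    [e_orbits], for [(i, j)] or for [(j, i)]. *)
Lemma orbits_disjoint i j a b :
  i != j -> iter a sigma (e i) <> iter b sigma (e j).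
Proof.
move=> neq_ij; case: (leqP a b) => [/subnK <-|/ltnW/subnK <-].
  rewrite addnC iterD => /iter_inj/esym; apply: e_orbits.
  by rewrite eq_sym.
by rewrite addnC iterD => /iter_inj; apply: e_orbits.
Qed.

Lemma orbits_orth i j a b :
  i != j -> iter a sigma (e i) * iter b sigma (e j) = 0.
Proof.
by move=> neq_ij; apply: primitive_idem_orth;
  [exact: primitive_idem_iter.. | exact: orbits_disjoint].
Qed.

Hypothesis e_moved : forall i, sigma (e i) <> e i.

(** [returns i] is the case in which [e i * z^(d i)] is not nilpotent and has to
    be split in two: [N] then contributes [e i * z] and [M] supplies the missing
    [d i - 1] powers of [z]. *)
Let returns i := (0 < d i)%N && (iter (d i) sigma (e i) == e i).
Let mid i := if returns i then 1%N else d i.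
Let N : S := \sum_(i | (0 < d i)%N) skC (e i) * skZ ^+ mid i.
Let M : S := \sum_(i | returns i) skC (sigma (e i)) * skZ ^+ (d i).-1.

Definition orbit_unit : S := (1 + N) * (1 + M).

(** For one [i] the required orthogonality reads [sigma^(mid i)(e i) <> e i]
    for [N] and [sigma^(d i - 1)(sigma(e i)) = e i <> sigma(e i)] for [M]; for two
    different [i] it is the disjointness of the orbits. *)
Lemma orbit_unitP : two_sided_unit orbit_unit.
Proof.
apply: two_sided_unitM; apply: two_sided_unit_1Dsq0; apply: skCZn_sum_sq0.
- move=> i j d_i _; have [<-|] := eqVneq i j; last exact: (orbits_orth _ 0).
  apply: primitive_idem_orth => //; first exact: primitive_idem_iter.
  rewrite /mid; case: ifP; first by move=> _; apply: e_moved.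
  by rewrite /returns d_i => /eqP.
move=> i j /andP[d_i /eqP ret_i] _; rewrite -iterSr prednK //.
have [<-|] := eqVneq i j; last exact: (orbits_orth _ 1).
rewrite ret_i; apply: primitive_idem_orth => //.
  exact: (primitive_idem_iter 1).
by move/esym; apply: e_moved.
Qed.

(** [e i] kills [M], so only [e i], [e i * N] and [e i * N * M] survive, and in
    each of these only the summands with index [i]. *)
Lemma skC_orbit_unit i :
  skC (e i) * orbit_unit =
    skC (e i) + (if (0 < d i)%N then skC (e i) * skZ ^+ mid i else 0)
    + (if returns i then skC (e i) * skZ ^+ d i else 0).
Proof.
have eN : skC (e i) * N = if (0 < d i)%N then skC (e i) * skZ ^+ mid i else 0.
  rewrite /N big_distrr /= [LHS]big_mkcond (bigD1 i) //= big1 => [|j neq_ji].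
    by rewrite addr0 mulrA skCM; have [_ -> _] := e_prim i.
  by rewrite mulrA skCM (orbits_orth 0 0) 1?eq_sym // skC0 mul0r if_same.
have eM : skC (e i) * M = 0.
  rewrite /M big_distrr big1 //= => j _; rewrite mulrA skCM.
  have [<-|neq_ij] := eqVneq i j; last first.
    by rewrite (orbits_orth 0 1) // skC0 mul0r.
  rewrite primitive_idem_orth ?skC0 ?mul0r //.
    exact: (primitive_idem_iter 1).
  by move/esym; apply: e_moved.
have NM : (if (0 < d i)%N then skC (e i) * skZ ^+ mid i else 0) * M =
          if returns i then skC (e i) * skZ ^+ d i else 0.
  have [d_i|/negPf d_i] := ifPn; last by rewrite mul0r /returns d_i.
  rewrite /M big_distrr /= [LHS]big_mkcond (bigD1 i) //= big1 => [|j neq_ji].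
    rewrite addr0; case: ifP => // ret_i; rewrite skCZn_mul /mid ret_i.
    have [_ se_se _] := primitive_idem_iter 1 sigma_bij (e_prim i).
    by rewrite se_se -skC_mulZn -mulrA -exprD add1n prednK.
  rewrite skCZn_mul (orbits_orth _ 1) 1?eq_sym // skC0 mulr0 mul0r.
  by rewrite if_same.
rewrite /orbit_unit mulrA (mulrDr (skC (e i))) mulr1 eN mulrDr mulr1 mulrDl eM NM.
by rewrite add0r.
Qed.

Lemma sksize_skC_orbit_unit i : sksize (skC (e i) * orbit_unit) = (d i).+1.
Proof.
have nz_e k : iter k sigma (e i) != 0.
  by have [] := primitive_idem_iter k sigma_bij (e_prim i).
rewrite skC_orbit_unit /mid; have [ret_i|_] := boolP (returns i).
  have /andP[d_i /eqP ret_e] := ret_i; rewrite d_i.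
  (* The middle term [e i * z] must not collide with the leading one. *)
  have d_gt1 : (1 < d i)%N.
    rewrite ltn_neqAle d_i andbT; apply/eqP => d1.
    by rewrite -d1 in ret_e; apply: (e_moved ret_e).
  apply: sksize_eqS => [|k lt_dk].
    rewrite !skcoefD skcoefC !skcoefCZn eqxx gtn_eqF // gtn_eqF //.
    by rewrite add0r add0r nz_e.
  by rewrite !skcoefD skcoefC !skcoefCZn !gtn_eqF ?addr0 // (leq_trans _ lt_dk).
rewrite addr0; have [d_i|] := ifPn.
  apply: sksize_eqS => [|k lt_dk].
    by rewrite skcoefD skcoefC skcoefCZn eqxx gtn_eqF // add0r nz_e.
  by rewrite skcoefD skcoefC skcoefCZn !gtn_eqF ?addr0 // (leq_trans _ lt_dk).
rewrite -eqn0Ngt addr0 => /eqP->; apply: sksize_eqS => [|k lt_0k].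
  by rewrite skcoefC; apply: (nz_e 0).
by rewrite skcoefC gtn_eqF.
Qed.

End OrbitUnit.

(** * Components in distinct orbits form a reduced sum *)

Section Reduced.

Variables (A : comNzRingType) (sigma : {rmorphism A -> A}).
Hypothesis sigma_bij : bijective sigma.
Local Notation S := (skewpoly sigma).
Local Notation skC := (skC sigma).
Local Notation skZ := (skZ sigma).
Variables (r : nat) (eps : 'I_r -> A).
Hypothesis eps_prim : forall k, primitive_idem (eps k).
Hypothesis eps_inj : injective eps.
Variables (I : finType) (l : I -> 'I_r).
Hypothesis l_orbits : forall i j, i != j ->
  forall m, iter m sigma (eps (l i)) <> eps (l j).

(** The coefficient of [z^m] in [eps c * g] is a multiple of [sigma^m(eps c)],
    hence lies over the orbit of [eps c], and it vanishes when [c] is none of the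
    [l i].  Right divisibility by [z^nu eps_p] forces a term to be supported on
    [eps_p], so a divisible term and the divisor share an orbit. *)
Lemma reduced_sum_skcomp (w : S) : reduced eps (\sum_i skcomp eps (l i) w).
Proof.
set g := \sum_i _; move=> k k' neq_kk' _ [nu p] [/= nz_nu _] [mu q] nz_term.
have coef_supp c m x : eps x * skcoef (skcomp eps c g) m != 0 ->
    exists2 i, c = l i & iter m sigma (eps (l i)) = eps x.
  rewrite skcoef_skcomp mulrA => nz.
  have [i /eqP eq_c|c_out] := pickP (fun i => c == l i).
    exists i => //; rewrite -eq_c; apply/eqP; apply: contraNT nz => /eqP neq.
    rewrite (primitive_idem_orth (e := eps x)) ?mul0r //.
      exact: primitive_idem_iter.
    by apply/nesym.
  case/eqP: nz; rewrite /g skcoef_sum big_distrr big1 //= => i _.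
  rewrite skcoef_skcomp mulrA -[X in X * _]mulrA -iter_rmorphM.
  rewrite (primitive_idem_orth (e := eps c)) ?iter_rmorph0 ?mulr0 ?mul0r //.
  by move/eps_inj => eq_c; have := c_out i; rewrite eq_c eqxx.
case=> h term_h.
(* The right factor [eps p] of the divisor fixes the term, whose only
   idempotent is [eps q]. *)
have eps_qp : eps q = eps p.
  apply/eqP; apply: contraNT nz_term => /eqP neq_qp; rewrite /term /=.
  have [_ pp _] := eps_prim p.
  have : skcoef (term eps (skcomp eps k g) (mu, q)) mu * eps p
       = skcoef (term eps (skcomp eps k g) (mu, q)) mu.
    by rewrite term_h /monom /= mulrA skcoefMC -mulrA pp.
  rewrite /term /= skcoefMC skcoefZn eqxx mul1r => <-.
  rewrite [eps q * _ * _]mulrAC (primitive_idem_orth (e := eps q)) // mul0r.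
  by rewrite skC0 mulr0.
have nz_mu : eps q * skcoef (skcomp eps k g) mu != 0.
  apply: contraNneq nz_term => eq0; rewrite /term /= eq0.
  by rewrite skC0 mulr0.
have [i def_k iter_i] := coef_supp _ _ _ nz_mu.
have [j def_k' iter_j] := coef_supp _ _ _ nz_nu.
have neq_ij : i != j.
  by apply: contraNneq neq_kk' => eq_ij; rewrite def_k eq_ij -def_k'.
have eq_orb : iter mu sigma ((eps \o l) i) = iter nu sigma ((eps \o l) j).
  by rewrite /= iter_i iter_j.
exact: (orbits_disjoint sigma_bij l_orbits neq_ij eq_orb).
Qed.

End Reduced.

(** * The idempotents of the cyclic algebra *)

Section CyclicAlgebra.

Variables (F : finFieldType) (n : nat).
Hypothesis n_gt0 : (0 < n)%N.
Local Notation A := (cyclic_algebra F n).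
Variables (r : nat) (ppi : 'I_r -> {poly F}).
Hypothesis ppi_monic : forall k, ppi k \is monic.
Hypothesis ppi_irr : forall k, irreducible_poly (ppi k).
Hypothesis ppi_inj : injective ppi.
Hypothesis ppi_prod : 'X^n - 1 = \prod_(k < r) ppi k.
Variable eps : 'I_r -> A.
Hypothesis eps_crt : crt_idempotents ppi eps.

(** Uniqueness in the Chinese remainder theorem, from existence: every family
    with the congruences of [eps] sums to [1]; adding [a - b] to its [k]-th member
    preserves the congruences, so [a - b = 0]. *)
Lemma cyclic_algebra_eq (k : 'I_r) (a b : A) :
  (forall j, (a : {poly F}) %% ppi j = (b : {poly F}) %% ppi j) -> a = b.
Proof.
move=> eq_ab; pose eps' i : A := if i == k then eps k + (a - b) else eps i.
have eps'_crt : crt_idempotents ppi eps'.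
  move=> i j; rewrite /eps'; case: eqP => [->|_]; last exact: eps_crt.
  by rewrite !modpD modpN eq_ab subrr addr0; apply: eps_crt.
have := crt_idempotents_sum n_gt0 ppi_monic ppi_irr ppi_inj ppi_prod eps_crt.
rewrite -(crt_idempotents_sum n_gt0 ppi_monic ppi_irr ppi_inj ppi_prod eps'_crt).
rewrite (bigD1 k) // [RHS](bigD1 k) //= /eps' eqxx.
under [X in _ = _ + X]eq_bigr => i /negPf-> do [].
move/addIr; rewrite -[LHS]addr0 => /addrI/esym/eqP.
by rewrite subr_eq0 => /eqP.
Qed.

(** Reduction modulo [x^n - 1] is invisible modulo its factor [ppi j]. *)
Lemma modp_cyclicM (a b : A) j :
  ((a * b : A) : {poly F}) %% ppi j = ((a : {poly F}) * (b : {poly F})) %% ppi j.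
Proof.
have monE : mk_monic ('X^n - 1 : {poly F}) = 'X^n - 1.
  by rewrite /mk_monic size_XnsubC // ltnS n_gt0 (monicXnsubC 1 n_gt0).
rewrite poly_of_qpolyM; move: (_ * _ : {poly F}) => c.
rewrite monE; set m := 'X^n - 1; have mon_m : m \is monic by apply: monicXnsubC.
rewrite [in RHS](Pdiv.RingMonic.rdivp_eq mon_m c) modpD [X in X + _]modp_eq0.
  by rewrite add0r.
by rewrite dvdp_mull // /m ppi_prod (bigD1 j) //= dvdp_mulr.
Qed.

Lemma eps_orth i j : i != j -> eps i * eps j = 0.
Proof.
move=> neq_ij; apply: (cyclic_algebra_eq i) => k.
rewrite modp_cyclicM -modp_mul eps_crt modp_mul mulrC -modp_mul eps_crt modp_mul.
rewrite mod0p; case: (j =P k) => [<-|]; rewrite ?mul0r ?mod0p //.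
by rewrite (negPf neq_ij) mulr0 mod0p.
Qed.

(** Since [ppi k] is prime it divides [f] or [f - 1] for an idempotent [f],
    which makes [f * eps k] congruent to [0] or to [eps k] modulo every factor. *)
Lemma eps_prim k : primitive_idem (eps k).
Proof.
split=> [||f ff].
- apply/eqP => eps0; have := eps_crt k k; rewrite eps0 eqxx mod0p => /esym/eqP.
  rewrite -/(ppi k %| 1) dvdp1; have [gt1 _] := ppi_irr k.
  by rewrite gtn_eqF.
- apply: (cyclic_algebra_eq k) => j.
  rewrite modp_cyclicM -modp_mul eps_crt modp_mul mulrC -modp_mul eps_crt.
  by rewrite modp_mul; case: (k == j); rewrite ?mulr1 ?mulr0.
have : ppi k %| (f : {poly F}) * ((f : {poly F}) - 1).
  rewrite mulrBr mulr1 /dvdp modpD modpN -modp_cyclicM ff.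
  by rewrite subrr.
have [dvd_f _|ndvd_f] := boolP (ppi k %| f); [left|].
  apply: (cyclic_algebra_eq k) => j; rewrite modp_cyclicM -modp_mul eps_crt.
  rewrite modp_mul mod0p; case: eqP => [<-|_]; last by rewrite mulr0 mod0p.
  by rewrite mulr1 modp_eq0.
rewrite Gauss_dvdpr ?irreducible_poly_coprime // => dvd_f1; right.
apply: (cyclic_algebra_eq k) => j; rewrite modp_cyclicM -modp_mul eps_crt modp_mul.
case: eqP => [<-|_]; last by rewrite mulr0.
by rewrite mulr1 -[in LHS](subrK 1 (f : {poly F})) modpD [X in X + _]modp_eq0 ?add0r.
Qed.

Lemma eps_inj : injective eps.
Proof.
move=> i j eq_ij; apply/eqP; apply/negPn/negP => /eps_orth.
have [nz_i ii _] := eps_prim i; rewrite -eq_ij ii.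
by move/eqP; apply/negP.
Qed.

End CyclicAlgebra.

Unset Implicit Arguments.

Theorem theorem4p2
  (F : finFieldType) (n : nat) (n_gt0 : (0 < n)%N) (n_coprime : coprime n #|F|)
  (r : nat) (ppi : 'I_r -> {poly F})
  (ppi_monic : forall k, ppi k \is monic)
  (ppi_irr : forall k, irreducible_poly (ppi k))
  (ppi_inj : injective ppi)
  (ppi_sorted : forall j k : 'I_r, (j <= k)%N -> (size (ppi j) <= size (ppi k))%N)
  (ppi_prod : 'X^n - 1 = \prod_(k < r) ppi k)
  (eps : 'I_r -> cyclic_algebra F n)
  (eps_crt : crt_idempotents ppi eps)
  (sigma : {lrmorphism cyclic_algebra F n -> cyclic_algebra F n})
  (sigma_bij : bijective sigma)
  (t : nat) (l : 'I_t -> 'I_r)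
  (l_orbits : forall i j, i != j -> ~ same_orbit sigma eps (l i) (l j))
  (l_period : forall i, (1 < period (bij_inj sigma_bij) (eps (l i)))%N)
  (d : 'I_t -> nat) :
  exists w : skewpoly sigma,
    [/\ two_sided_unit w,
        reduced eps (\sum_(i < t) skcomp eps (l i) w)
      & forall i, sksize (skcomp eps (l i) w) = (d i).+1].
Proof.
have prim := eps_prim n_gt0 ppi_monic ppi_irr ppi_inj ppi_prod eps_crt.
have inj := eps_inj n_gt0 ppi_monic ppi_irr ppi_inj ppi_prod eps_crt.
have orbits i j : i != j -> forall m, iter m sigma (eps (l i)) <> eps (l j).
  by move=> neq_ij m eq_m; apply: (l_orbits i j neq_ij); exists m.
have moved i : sigma (eps (l i)) <> eps (l i).
  have := l_period i; rewrite /period; case: ex_minnP => m _ min_m gt1 fixed.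
  by have := min_m 1%N; rewrite /= fixed eqxx => /(_ isT); rewrite leqNgt gt1.
exists (orbit_unit sigma (eps \o l) d); split.
- exact: (orbit_unitP sigma_bij d (fun i => prim (l i)) orbits moved).
- exact: reduced_sum_skcomp.
exact: (sksize_skC_orbit_unit sigma_bij d (fun i => prim (l i)) orbits moved).
Qed.
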